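(* For every $\theta_0\in\mathbb{R}$, every constant $C\in\mathbb{R}$ and every $t_n$ with $t_1\le t_n\le t_N$, $$b(t_n;\theta=\theta_0)+C=b(t_n;\theta=\theta_0+C),$$ where $b(t_n;\theta=c)$ denotes the threshold at time $t_n$ in the purchasing problem described in the context when the long-run average price is $\theta=c$, all other parameters being kept the same.
   Context: Model. A single item must be purchased within a finite horizon $[0,T]$. Decisions are made on the grid $t_n = n\cdot dt$, $0\le n\le N$, with $dt>0$ and $N=T/dt$. The item's price follows the AR(1) process $X_t = \theta K\,dt + (1-K\,dt)X_{t-dt} + \sigma\varepsilon_t$, where $\theta\in\mathbb{R}$, $\sigma>0$, $|1-K\,dt|<1$, and the $\varepsilon_{t_1},\varepsilon_{t_2},\dots$ are i.i.d. $N(0,dt)$. For $t_n<t_i$, $X_{t_n,t_i}(x)$ denotes the random price $X_{t_i}$ conditioned on $X_{t_n}=x$. Holding the item from $t_n$ to $t_N$ costs $dt\sum_{i=n}^{N-1}h_{t_i}$, where the per-unit-time holding costs $h_{t_0},\dots,h_{t_{N-1}}$ are real numbers that are weakly decreasing in time. Value function. $V(x,t_N)=x$ (the item must be bought at $t_N$ if not bought before), and for $0\le n<N$, $$V(x,t_n)=\min\Big\{V^C(x,t_n),\; x+dt\sum_{i=n}^{N-1}h_{t_i}\Big\},\qquad V^C(x,t_n)=E\big[V(X_{t_n,t_{n+1}}(x),t_{n+1})\big].$$ Threshold. For $0\le n\le N-1$, $b(t_n)$ is the (single) real number with $V^C(b(t_n),t_n)=b(t_n)+dt\sum_{i=n}^{N-1}h_{t_i}$;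 by convention $b(t_N)=\infty$ (so $b(t_N)+C=\infty$). *)

(* Defs.v *)
From HB Require Import structures.
From mathcomp Require Import all_boot all_order all_algebra.
From mathcomp Require Import all_classical all_reals all_analysis.

Set Implicit Arguments.
Unset Strict Implicit.
Unset Printing Implicit Defensive.

Import Order.TTheory GRing.Theory Num.Theory.
Import numFieldNormedType.Exports.

Local Open Scope classical_set_scope.
Local Open Scope ring_scope.

(* Grid times t_n = n * dt are represented by their index n : nat. *)

(* Mutual independence of the subfamily (X i), i in D: the product rule holds
   for every finite subfamily, enumerated without repetition by s. *)
Definition mutually_independent (d : measure_display) (Omega : measurableType d)
    (R : realType) (P : probability Omega R) (D : set nat)
    (X : nat -> {RV P >-> R}) : Prop :=
  forall (s : seq nat) (A : nat -> set R),
    uniq s -> [set` s] `<=` D -> (forall i, measurable (A i)) ->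
    P (\big[setI/setT]_(i <- s) (X i @^-1` A i)) =
    (\prod_(i <- s) P (X i @^-1` A i))%E.

(* eps i is the shock at time t_i; only the indices i >= 1 occur.
   [normal_prob m s] is parameterized by the standard deviation s, so the law
   N(0, dt) of variance dt is [normal_prob 0 (Num.sqrt dt)]. *)
Definition iid_normal_shocks (d : measure_display) (Omega : measurableType d)
    (R : realType) (P : probability Omega R) (dt : R)
    (eps : nat -> {RV P >-> R}) : Prop :=
  (forall i, (0 < i)%N -> forall A : set R, measurable A ->
     distribution P (eps i) A = normal_prob 0 (Num.sqrt dt) A) /\
  mutually_independent [set i | (0 < i)%N] eps.

(* [price eps dt K sigma theta n x k] is the random price X_{t_n, t_{n+k}}(x):
   the AR(1) recursion run for k steps from the value x at time t_n. *)
Fixpoint price (d : measure_display) (Omega : measurableType d)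
    (R : realType) (P : probability Omega R) (eps : nat -> {RV P >-> R})
    (dt K sigma theta : R) (n : nat) (x : R) (k : nat) (w : Omega) : R :=
  if k is k'.+1 then
    theta * K * dt
    + (1 - K * dt) * price eps dt K sigma theta n x k' w
    + sigma * eps (n + k)%N w
  else x.

Definition holding_cost (R : realType) (dt : R) (N : nat) (h : nat -> R)
    (n : nat) : R :=
  dt * \sum_(n <= i < N) h i.

(* Backward induction: [value_togo .. k x] is V(x, t_{N-k}). The expectation
   is extended-real valued, hence [fine]. *)
Fixpoint value_togo (d : measure_display) (Omega : measurableType d)
    (R : realType) (P : probability Omega R) (eps : nat -> {RV P >-> R})
    (dt : R) (N : nat) (K sigma : R) (h : nat -> R) (theta : R)
    (k : nat) (x : R) : R :=
  if k is k'.+1 then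
    Num.min
      (fine 'E_P[fun w => value_togo eps dt N K sigma h theta k'
                            (price eps dt K sigma theta (N - k)%N x 1%N w)])
      (x + holding_cost dt N h (N - k)%N)
  else x.

Definition value (d : measure_display) (Omega : measurableType d)
    (R : realType) (P : probability Omega R) (eps : nat -> {RV P >-> R})
    (dt : R) (N : nat) (K sigma : R) (h : nat -> R) (theta : R)
    (x : R) (n : nat) : R :=
  value_togo eps dt N K sigma h theta (N - n)%N x.

Definition continuation_value (d : measure_display) (Omega : measurableType d)
    (R : realType) (P : probability Omega R) (eps : nat -> {RV P >-> R})
    (dt : R) (N : nat) (K sigma : R) (h : nat -> R) (theta : R)
    (x : R) (n : nat) : R :=
  fine 'E_P[fun w => value eps dt N K sigma h theta
                       (price eps dt K sigma theta n x 1%N w) n.+1].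

Lemma value_terminal (d : measure_display) (Omega : measurableType d)
    (R : realType) (P : probability Omega R) (eps : nat -> {RV P >-> R})
    (dt : R) (N : nat) (K sigma : R) (h : nat -> R) (theta x : R) :
  value eps dt N K sigma h theta x N = x.
Proof. by rewrite /value subnn. Qed.

Lemma value_step (d : measure_display) (Omega : measurableType d)
    (R : realType) (P : probability Omega R) (eps : nat -> {RV P >-> R})
    (dt : R) (N : nat) (K sigma : R) (h : nat -> R) (theta x : R) (n : nat) :
  (n < N)%N ->
  value eps dt N K sigma h theta x n =
  Num.min (continuation_value eps dt N K sigma h theta x n)
          (x + holding_cost dt N h n).
Proof.
by move=> nN; rewrite /continuation_value /value -(subnSK nN) /= subnSK// subKn// ltnW.
Qed.

(* For n < N, the (single) real b with V^C(b, t_n) = b + dt * sum_i h_{t_i};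
   the default 0 of [xget] would be returned only if there were none. At the
   last time the threshold is +oo. *)
Definition threshold (d : measure_display) (Omega : measurableType d)
    (R : realType) (P : probability Omega R) (eps : nat -> {RV P >-> R})
    (dt : R) (N : nat) (K sigma : R) (h : nat -> R) (theta : R)
    (n : nat) : \bar R :=
  if (n < N)%N then
    (xget 0 [set b : R | continuation_value eps dt N K sigma h theta b n =
                         b + holding_cost dt N h n])%:E
  else +oo%E.

(* Main.v *)
Require Import Defs.
From HB Require Import structures.
From mathcomp Require Import all_boot all_order all_algebra.
From mathcomp Require Import all_classical all_reals all_analysis.
From mathcomp Require Import measurable_realfun.
From mathcomp Require Import ring lra.

Import Order.TTheory GRing.Theory Num.Theory.
Import numFieldNormedType.Exports.

Local Open Scope classical_set_scope.
Local Open Scope ring_scope.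

(* Conditioning on X_{t_n} = x, the next price is affine in x with slope
   a = 1 - K dt, |a| < 1. As the shocks are integrable, backward induction shows
   that every V(., t_n) is 1-Lipschitz, so that V^C(., t_n) is |a|-Lipschitz and
   V^C(., t_n) - H, with H the holding cost, is a contraction: b(t_n) is its
   unique fixed point. Replacing (theta, x) by (theta + C, x + C) shifts every
   later price, hence V and V^C, by C, and so also the fixed point. *)

(** * First absolute moment of a Gaussian *)

Lemma ge0_integral_normal_prob (R : realType) (m s : R) (f : R -> \bar R) :
  measurable_fun setT f -> (forall x, 0 <= f x)%E ->
  (\int[normal_prob m s]_x f x =
   \int[lebesgue_measure]_x (f x * (normal_pdf m s x)%:E))%E.
Proof.
move=> mf f0; have dom := normal_prob_dominates m s.
rewrite -(Radon_Nikodym_SigmaFinite.change_of_variables dom)//.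
have intRN := Radon_Nikodym_SigmaFinite.f_integrable dom.
have mpdf : measurable_fun [set: R] (EFin \o normal_pdf m s).
  by apply/measurable_EFinP; exact: measurable_normal_pdf.
apply: ae_eq_integral => //.
- by apply: emeasurable_funM => //; exact: measurable_int intRN.
- exact: emeasurable_funM.
(* The Radon-Nikodym derivative and [normal_pdf] both integrate to the Gaussian mass over every
   measurable set, so they agree almost everywhere. *)
- apply: ae_eqe_mul2l; apply: integral_ae_eq => // A _ mA.
  by rewrite -Radon_Nikodym_SigmaFinite.f_integral.
Qed.

(* The factor |x| is absorbed by doubling the standard deviation: the ratio of
   the two Gaussians is e^(3u) >= 1 + 3u with u = x^2 / (8 s^2). *)
Lemma normr_normal_pdf_le (R : realType) (s x : R) : s != 0 ->
  `|x| * normal_pdf 0 s x <=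
  (1 + 8 * s ^+ 2) * normal_peak s / normal_peak (2 * s) *
  normal_pdf 0 (2 * s) x.
Proof.
move=> s0; have s20 : 2 * s != 0 by rewrite mulf_neq0.
rewrite !normal_pdfE// [leRHS]mulrA divfK ?gt_eqF ?normal_peak_gt0//.
rewrite [leLHS]mulrCA [leRHS]mulrAC [leRHS]mulrC ler_wpM2l ?normal_peak_ge0//.
rewrite /normal_fun subr0; set u := x ^+ 2 / (8 * s ^+ 2).
have u0 : 0 <= u by rewrite divr_ge0 ?sqr_ge0// mulr_ge0// sqr_ge0.
have -> : - x ^+ 2 / (s ^+ 2 *+ 2) = - u - 3 * u by rewrite /u; field.
have -> : - x ^+ 2 / ((2 * s) ^+ 2 *+ 2) = - u by rewrite /u; field.
rewrite expRD mulrCA mulrC ler_wpM2r ?expR_ge0// expRN ler_pdivrMr ?expR_gt0//.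
have xE : x ^+ 2 = u * (8 * s ^+ 2) by rewrite divfK ?mulf_neq0 ?expf_neq0.
(* From [(|x| - 1)^2 >= 0] one gets [2|x| <= 1 + x^2 = 1 + 8 s^2 u], which is below twice the
   product on the right. *)
apply: (@le_trans _ _ ((1 + 8 * s ^+ 2) * (1 + 3 * u))).
  have s2 := sqr_ge0 s; have := sqr_ge0 (`|x| - 1).
  by rewrite sqrrB1 real_normK ?num_real// xE; nra.
by rewrite ler_wpM2l ?expR_ge1Dx// addr_ge0// mulr_ge0// sqr_ge0.
Qed.

(** The integrand is at most [c] times the density of standard deviation [2 * s], whose total mass
    is 1. *)
Lemma integral_normal_prob_normr_lty (R : realType) (s : R) : s != 0 ->
  (\int[normal_prob 0 s]_x `|x|%:E < +oo)%E.
Proof.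
move=> s0; rewrite ge0_integral_normal_prob//; last first.
  by apply/measurable_EFinP; exact: normr_measurable.
set c := (1 + 8 * s ^+ 2) * normal_peak s / normal_peak (2 * s).
have c0 : 0 <= c.
  do !apply: mulr_ge0; rewrite ?invr_ge0 ?normal_peak_ge0//.
  by rewrite addr_ge0// mulr_ge0// sqr_ge0.
apply: (@le_lt_trans _ _
    (\int[lebesgue_measure]_x (c%:E * (normal_pdf 0 (2 * s) x)%:E))%E).
  apply: ge0_le_integral => //.
  - by move=> x _; rewrite mule_ge0// lee_fin normal_pdf_ge0.
  - apply/measurable_EFinP/measurable_funM; first exact: normr_measurable.
    exact: measurable_normal_pdf.
  - by apply/measurable_EFinP/measurable_funM => //; exact: measurable_normal_pdf.
  - by move=> x _; rewrite -!EFinM lee_fin; exact: normr_normal_pdf_le.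
rewrite integralZl ?integral_normal_pdf ?mule1 ?ltry//.
exact: integrable_normal_pdf.
Qed.

(** * Fixed points of contractions and Lipschitz bounds *)

Lemma contraction_has_fixpoint (R : realType) (g : R -> R) (q : R) :
  0 <= q -> q < 1 -> (forall x y, `|g x - g y| <= q * `|x - y|) ->
  exists x, g x = x.
Proof.
move=> q0 q1 gq.
have [x _ gx] : exists2 x, [set: R] x & x = totalfun_ setT g x.
  (* Banach's theorem concerns self-maps of a nonempty closed set, so [g] is packaged as a self-map
     of [setT]. *)
  apply: (@banach_fixed_point R R setT (totalfun_ setT g)).
  - by exists (NngNum q0); split => //= -[x y] _; exact: gq.
  - exact: closedT.
  - by exists 0.
by exists x.
Qed.

Lemma ler_dist_min (R : realDomainType) (a b c d e : R) :
  `|a - c| <= e -> `|b - d| <= e -> `|Num.min a b - Num.min c d| <= e.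
Proof.
rewrite !ler_norml => /andP[? ?] /andP[? ?]; apply/andP.
by rewrite /Num.min; case: ifPn; case: ifPn; rewrite -?leNgt => ? ?; lra.
Qed.

(** * Expectations of Lipschitz functions of a random variable *)

Section expectation_lipschitz.
Context (d : measure_display) (Omega : measurableType d) (R : realType).
Context (P : probability Omega R).
Implicit Types X Y Z : Omega -> R.

Lemma fine_expectationE X : fine 'E_P[X] = (\int[P]_w X w)%R.
Proof. by rewrite unlock. Qed.

Lemma dist_expectation_le X Y (c : R) :
  P.-integrable setT (EFin \o X) -> P.-integrable setT (EFin \o Y) ->
  (forall w, `|X w - Y w| <= c) -> `|fine 'E_P[X] - fine 'E_P[Y]| <= c.
Proof.
move=> iX iY XYc; rewrite !fine_expectationE -RintegralB//.
have iXY : P.-integrable setT (EFin \o (X \- Y)).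
  exact: (integrableB _ iX iY).
apply: (le_trans (le_normr_Rintegral _ iXY)) => //.
have -> : c = (\int[P]_(w in setT) c)%R.
  by rewrite Rintegral_cst//= probability_setT mulr1.
apply: le_Rintegral => //.
- exact: integrable_norm iXY.
- exact: finite_measure_integrable_cst.
- by move=> w _; exact: XYc.
Qed.

Lemma fine_expectationDr X (c : R) : P.-integrable setT (EFin \o X) ->
  fine 'E_P[fun w => X w + c] = fine 'E_P[X] + c.
Proof.
move=> iX; rewrite !fine_expectationE RintegralD//; last first.
  exact: finite_measure_integrable_cst.
by rewrite Rintegral_cst//= probability_setT mulr1.
Qed.

Lemma lipschitz1_measurable (f : R -> R) :
  (forall x y, `|f x - f y| <= `|x - y|) -> measurable_fun setT f.
Proof.
move=> f1; apply: continuous_measurable_fun => x.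
apply/cvgrPdist_lt => e e0; near=> y; apply: (le_lt_trans (f1 x y)).
by near: y; exact: cvgr_dist_lt.
Unshelve. all: by end_near. Qed.

(** Domination: [|f (X w)| <= |f 0| + |X w|], and constants are integrable under a probability. *)
Lemma lipschitz1_integrable (f : R -> R) X :
  (forall x y, `|f x - f y| <= `|x - y|) ->
  P.-integrable setT (EFin \o X) -> P.-integrable setT (EFin \o (f \o X)).
Proof.
move=> f1 iX.
have mX : measurable_fun setT X by exact/measurable_EFinP/(measurable_int P).
have iY : P.-integrable setT (EFin \o (fun w => `|f 0| + `|X w|)).
  exact: (integrableD _ (finite_measure_integrable_cst P _ measurableT)
    (integrable_norm iX)).
apply: le_integrable iY => //.
  apply/measurable_EFinP; apply: measurableT_comp mX.
  exact: lipschitz1_measurable.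
move=> w _ /=; rewrite lee_fin [leRHS]ger0_norm ?addr_ge0//.
by rewrite -[f _](subrK (f 0)) (le_trans (ler_normD _ _))// addrC lerD2l
  (le_trans (f1 _ _))// subr0.
Qed.

End expectation_lipschitz.

(** * Lipschitz bounds, translation and thresholds in the purchasing problem *)

Section purchasing_problem.
Context (d : measure_display) (Omega : measurableType d) (R : realType).
Context (P : probability Omega R) (eps : nat -> {RV P >-> R}).
Context (dt : R) (N : nat) (K sigma : R) (h : nat -> R).
Hypothesis K_stable : `|1 - K * dt| < 1.
Hypothesis eps_integrable :
  forall i, (0 < i)%N -> P.-integrable setT (EFin \o eps i).

Let price := price eps dt K sigma.
Let value_togo := value_togo eps dt N K sigma h.
Let continuation_value := continuation_value eps dt N K sigma h.

Lemma price1_integrable (theta : R) (n : nat) (x : R) :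
  P.-integrable setT (EFin \o price theta n x 1).
Proof.
have iE : P.-integrable setT (EFin \o (fun w => sigma * eps (n + 1)%N w)).
  have n1 : (0 < n + 1)%N by rewrite addn1.
  exact: (integrableZl measurableT sigma (eps_integrable _ n1)).
set c := theta * K * dt + (1 - K * dt) * x.
exact: (integrableD _ (finite_measure_integrable_cst P c measurableT) iE).
Qed.

(** The weights [K * dt] of [theta] and [1 - K * dt] of [x] add up to 1. *)
Lemma price1_shift (theta : R) (n : nat) (x C : R) (w : Omega) :
  price (theta + C) n (x + C) 1 w = price theta n x 1 w + C.
Proof. by rewrite /price /=; ring. Qed.

(** Both prices are driven by the same shock, so their difference is the deterministic
    [(1 - K * dt) * (x - y)]. *)
Lemma expectation_price1_lipschitz (f : R -> R) (theta : R) (n : nat) (x y : R) :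
  (forall x y, `|f x - f y| <= `|x - y|) ->
  `|fine 'E_P[fun w => f (price theta n x 1 w)] -
    fine 'E_P[fun w => f (price theta n y 1 w)]| <=
  `|1 - K * dt| * `|x - y|.
Proof.
move=> f1; apply: dist_expectation_le.
- exact: lipschitz1_integrable f1 (price1_integrable theta n x).
- exact: lipschitz1_integrable f1 (price1_integrable theta n y).
- move=> w; apply: (le_trans (f1 _ _)); rewrite -normrM /price /=.
  by rewrite le_eqVlt; apply/orP; left; apply/eqP; congr `|_|; ring.
Qed.

(** Of the two branches of the minimum, waiting contracts distances and buying preserves them. The
    bound also makes the next value integrable, as the shift lemmas below require. *)
Lemma value_togo_lipschitz1 (theta : R) (k : nat) (x y : R) :
  `|value_togo theta k x - value_togo theta k y| <= `|x - y|.
Proof.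
elim: k x y => [//|k IHk] x y; apply: ler_dist_min; last first.
  by rewrite opprD addrACA subrr addr0.
apply: (le_trans (expectation_price1_lipschitz _ theta (N - k.+1)%N x y IHk)).
by rewrite ler_piMl// ltW.
Qed.

Lemma value_togo_shift (theta C : R) (k : nat) (x : R) :
  value_togo (theta + C) k (x + C) = value_togo theta k x + C.
Proof.
elim: k x => [//|k IHk] x; rewrite /value_togo /= -/value_togo.
rewrite addr_minl; congr (Num.min _ _); last by rewrite addrAC.
(* Integrability is what allows [C] to enter the expectation; the shift then holds for each outcome
   [w]. *)
rewrite -fine_expectationDr; last first.
  exact: lipschitz1_integrable (value_togo_lipschitz1 theta k)
    (price1_integrable theta _ x).
by congr (fine 'E_P[_]); apply/funext => w; rewrite -IHk -price1_shift.
Qed.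

Lemma continuation_value_shift (theta C x : R) (n : nat) :
  continuation_value (theta + C) (x + C) n = continuation_value theta x n + C.
Proof.
rewrite -fine_expectationDr; last first.
  exact: lipschitz1_integrable (value_togo_lipschitz1 theta _)
    (price1_integrable theta n x).
congr (fine 'E_P[_]); apply/funext => w.
by rewrite -value_togo_shift -price1_shift.
Qed.

Lemma continuation_value_contraction (theta : R) (n : nat) (x y : R) :
  `|continuation_value theta x n - continuation_value theta y n| <=
  `|1 - K * dt| * `|x - y|.
Proof. exact: expectation_price1_lipschitz (value_togo_lipschitz1 theta _). Qed.

Lemma threshold_equation_exists (theta : R) (n : nat) :
  exists b, continuation_value theta b n = b + holding_cost dt N h n.
Proof.
have [|b bE] := @contraction_has_fixpoint R
  (fun x => continuation_value theta x n - holding_cost dt N h n)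
  _ (normr_ge0 _) K_stable.
  move=> x y; rewrite opprB addrA subrK.
  exact: continuation_value_contraction.
by exists b; rewrite -[in RHS]bE subrK.
Qed.

Lemma threshold_equation_unique (theta : R) (n : nat) (b c : R) :
  continuation_value theta b n = b + holding_cost dt N h n ->
  continuation_value theta c n = c + holding_cost dt N h n -> b = c.
Proof.
move=> bE cE; have := continuation_value_contraction theta n b c.
rewrite bE cE opprD addrACA subrr addr0 => bc.
apply/eqP; rewrite -subr_eq0 -normr_eq0; apply/negPn/negP => bc0.
have bc_gt0 : 0 < `|b - c| by rewrite lt_def bc0 normr_ge0.
by move: bc; rewrite leNgt gtr_pMl ?K_stable.
Qed.

(** Since [b] solves the equation and no other real does, [xget] returns [b] rather than an
    arbitrary choice or its default [0]. *)
Lemma thresholdE (theta : R) (n : nat) (b : R) : (n < N)%N ->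
  continuation_value theta b n = b + holding_cost dt N h n ->
  threshold eps dt N K sigma h theta n = b%:E.
Proof.
move=> nN bE; rewrite /threshold nN; congr EFin.
by apply: xget_unique => // c cE; exact: threshold_equation_unique cE bE.
Qed.

End purchasing_problem.

(** The mean of [|eps i|] is an integral against its Gaussian law, whose standard deviation is
    nonzero because [dt] is positive. *)
Lemma iid_normal_shocks_integrable (d : measure_display)
    (Omega : measurableType d) (R : realType) (P : probability Omega R)
    (dt : R) (eps : nat -> {RV P >-> R}) (i : nat) :
  0 < dt -> iid_normal_shocks dt eps -> (0 < i)%N ->
  P.-integrable setT (EFin \o eps i).
Proof.
move=> dt0 [epsN _] i0; apply/integrableP; split.
  by apply/measurable_EFinP; exact: measurable_funPT.
(* [normal_prob] is a measure on [measurableTypeR R], whose display is not that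
   of [R], so the law of [eps i] is transported there. *)
have meps : measurable_fun (U := measurableTypeR R) setT (eps i).
  exact: (measurable_funPT (eps i)).
pose X : {mfun Omega >-> measurableTypeR R} :=
  HB.pack (eps i : Omega -> measurableTypeR R)
    (isMeasurableFun.Build _ _ _ _ _ meps).
have -> : (\int[P]_w `|(EFin \o eps i) w| =
    \int[distribution P X]_y `|y|%:E)%E.
  rewrite ge0_integral_distribution//.
  by apply/measurable_EFinP; exact: normr_measurable.
rewrite (eq_measure_integral (normal_prob 0 (Num.sqrt dt))).
  by apply: integral_normal_prob_normr_lty; rewrite gt_eqF// sqrtr_gt0.
by move=> A mA _; exact: epsN.
Qed.

Theorem lemma4 (d : measure_display) (Omega : measurableType d)
    (R : realType) (P : probability Omega R)
    (T dt : R) (N : nat) (K sigma : R)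
    (eps : nat -> {RV P >-> R}) (h : nat -> R)
    (dt_gt0 : 0 < dt)
    (N_def : N%:R = T / dt)
    (sigma_gt0 : 0 < sigma)
    (K_stable : `|1 - K * dt| < 1)
    (eps_iid : iid_normal_shocks dt eps)
    (h_decr : forall i j : nat, (i <= j)%N -> (j < N)%N -> h j <= h i)
    (theta0 C : R) (n : nat) (n_ge1 : (1 <= n)%N) (n_leN : (n <= N)%N) :
  (threshold eps dt N K sigma h theta0 n + C%:E)%E =
  threshold eps dt N K sigma h (theta0 + C) n.
Proof.
(* At [n = N] both thresholds are [+oo], which absorbs [C]. *)
have [nN|Nn] := ltnP n N; last by rewrite /threshold ltnNge Nn.
have eps_int i := iid_normal_shocks_integrable _ _ _ P dt eps i dt_gt0 eps_iid.
have [b bE] := threshold_equation_exists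
  _ _ _ _ _ _ N _ sigma h K_stable eps_int theta0 n.
rewrite (thresholdE _ _ _ _ _ _ _ _ _ _ K_stable eps_int _ _ b)//.
(* The candidate [b + C] solves the equation for [theta0 + C], since both sides move by [C] and the
   holding cost stays fixed. *)
rewrite (thresholdE _ _ _ _ _ _ _ _ _ _ K_stable eps_int _ _ (b + C))//.
by rewrite continuation_value_shift// bE addrAC.
Qed.
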